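(* Let $\lambda_*\in\mathbb{C}$ be an eigenvalue of a discrete Sturm-Liouville problem $(\boldsymbol{\omega},\mathbf{A})\in\Omega_N^{\mathbb{C}}\times\mathcal{A}^{\mathbb{C}}$ with multiplicity $m$, let $R$ be a bounded open subset of $\mathbb{C}$ such that $\lambda_*\in R$, and assume that $\lambda_*$ is the only eigenvalue of $(\boldsymbol{\omega},\mathbf{A})$ in the closure $\bar R$ of $R$. Then there is a neighborhood $\mathcal{U}$ of $(\boldsymbol{\omega},\mathbf{A})$ in $\Omega_N^{\mathbb{C}}\times\mathcal{A}^{\mathbb{C}}$ such that each problem in $\mathcal{U}$ has exactly $m$ eigenvalues in $\bar R$, counting multiplicity, and they all lie in $R$.
   Context: $N\ge2$ is an integer, $\Delta y_n=y_{n+1}-y_n$, $\nabla y_n=y_n-y_{n-1}$. A discrete Sturm-Liouville equation $-\nabla(f_n\Delta y_n)+q_ny_n=\lambda w_ny_n$, $1\le n\le N$, with complex coefficients, $f_n\ne0$ ($0\le n\le N$), $w_n\neq0$ ($1\le n\le N$), is identified with $\boldsymbol{\omega}=(1/f,q,w)=(1/f_0,\dots,1/f_N,q_1,\dots,q_N,w_1,\dots,w_N)$; $\Omega_N^{\mathbb{C}}\subset\mathbb{C}^{3N+1}$ is the (open) set of all such triples with the induced topology. A boundary condition is $A\begin{pmatrix}y_0\\ f_0\Delta y_0\end{pmatrix}+B\begin{pmatrix}y_N\\ f_N\Delta y_N\end{pmatrix}=0$ with $A,B$ complex $2\times2$ matrices, $\mathrm{rank}(A,B)=2$; it is denoted $\mathbf{A}=[A\,|\,B]$,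 where $(A,B)$ and $(TA,TB)$, $T\in GL(2,\mathbb{C})$, are identified. $\mathcal{A}^{\mathbb{C}}$ is the resulting quotient space with the quotient topology. A complex number $\lambda$ is an eigenvalue of the problem if there is a nonzero sequence $y=\{y_n\}_{n=0}^{N+1}$ of complex numbers satisfying both the equation and the boundary condition. $\phi(\lambda),\psi(\lambda)$ are the solutions of the equation with $\phi_0=1$, $f_0\Delta\phi_0=0$, $\psi_0=0$, $f_0\Delta\psi_0=1$, and $\Phi_N(\lambda)=\begin{pmatrix}\phi_N(\lambda)&\psi_N(\lambda)\\ f_N\Delta\phi_N(\lambda)&f_N\Delta\psi_N(\lambda)\end{pmatrix}$. The (analytic) multiplicity of an eigenvalue is its order as a zero of the polynomial $\Gamma(\lambda)=\det(A+B\Phi_N(\lambda))$ (well defined up to a nonzero constant factor). *)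

(* Defs.v *)
From HB Require Import structures.
From mathcomp Require Import all_boot all_order all_algebra.
From mathcomp Require Import generic_quotient.
From mathcomp Require Import complex.
From mathcomp Require Import all_classical all_reals topology normedtype.

Set Implicit Arguments.
Unset Strict Implicit.
Unset Printing Implicit Defensive.

Import Order.TTheory GRing.Theory Num.Theory.
Import numFieldNormedType.Exports.

Local Open Scope classical_set_scope.
Local Open Scope ring_scope.
Local Open Scope complex_scope.
Local Open Scope quotient_scope.

(* The usual topology on the complex numbers, given by the modulus. *)
HB.instance Definition _ (R : realType) :=
  PseudoPointedMetric.copy R[i] R[i]^o.
HB.instance Definition _ (R : realType) :=
  PseudoMetricNormedZmod.copy R[i] R[i]^o.

Section Equation.
Variables (R : realType) (N : nat).
Local Notation C := R[i].

(* A point of C^(3N+1) is a triple x = ((r, q), w) with r = (1/f_0, ..., 1/f_N),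
   q = (q_1, ..., q_N) and w = (w_1, ..., w_N): the first component holds the
   inverses of the f_n, and the indices of q and w are shifted by one. *)
Definition Omega_set :=
  [set x : 'rV[C]_N.+1 * 'rV[C]_N * 'rV[C]_N |
    (forall i, x.1.1 0 i != 0) /\ (forall i, x.2 0 i != 0)].

Definition Omega : Type := set_type Omega_set.
HB.instance Definition _ := Topological.copy Omega (set_type Omega_set).

Implicit Types (omega : Omega) (y : nat -> C) (lambda : C).

Definition entry (k : nat) (v : 'rV[C]_k) (n : nat) : C :=
  if insub n is Some i then v 0 i else 0.

Definition sl_f omega (n : nat) : C := (entry (val omega).1.1 n)^-1.
Definition sl_q omega (n : nat) : C := entry (val omega).1.2 n.-1.
Definition sl_w omega (n : nat) : C := entry (val omega).2 n.-1.

(* f_n Delta y_n *)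
Definition quasi_diff omega y (n : nat) : C := sl_f omega n * (y n.+1 - y n).

(* Only the values y_0, ..., y_{N+1} are involved. *)
Definition sl_equation omega lambda y : Prop :=
  forall n, (1 <= n <= N)%N ->
    - (quasi_diff omega y n - quasi_diff omega y n.-1) + sl_q omega n * y n
      = lambda * sl_w omega n * y n.

(* The column (y_n, f_n Delta y_n). *)
Definition sl_state omega y (n : nat) : 'cV[C]_2 :=
  \col_(i < 2) if i == 0 then y n else quasi_diff omega y n.

(* The pair (y_n, f_n Delta y_n) of polynomials in lambda, where y is the
   solution of the equation with y_0 = a and f_0 Delta y_0 = b. *)
Fixpoint sl_solution omega (a b : C) (n : nat) : {poly C} * {poly C} :=
  if n is k.+1 then
    let: (y, u) := sl_solution omega a b k in
    let y' := y + (sl_f omega k)^-1 *: u in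
    (y', u + ((sl_q omega k.+1)%:P - sl_w omega k.+1 *: 'X) * y')
  else (a%:P, b%:P).

(* The columns of Phi_N are the states at N of phi and psi. *)
Definition Phi omega : 'M[{poly C}]_2 :=
  \matrix_(i, j)
    let s := if j == 0 then sl_solution omega 1 0 N
             else sl_solution omega 0 1 N in
    if i == 0 then s.1 else s.2.

Lemma sl_f_neq0 omega n : (n <= N)%N -> sl_f omega n != 0.
Proof.
move=> leNn; rewrite /sl_f /entry insubT invr_eq0.
by have [r_neq0 _] := set_mem (valP omega); exact: r_neq0.
Qed.

Section SolutionSpec.
Variables (omega : Omega) (lambda a b : C).
Let y n := (sl_solution omega a b n).1.[lambda].

Lemma quasi_diff_sl_solution n : (n <= N)%N ->
  quasi_diff omega y n = (sl_solution omega a b n).2.[lambda].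
Proof.
move=> leNn; rewrite /quasi_diff /y /=.
case: (sl_solution omega a b n) => p u /=.
by rewrite hornerD hornerZ addrC addKr mulrA mulfV ?mul1r // sl_f_neq0.
Qed.

Lemma sl_solution0 : y 0%N = a /\ quasi_diff omega y 0%N = b.
Proof. by rewrite quasi_diff_sl_solution // /y /= !hornerC. Qed.

Lemma sl_solutionP : sl_equation omega lambda y.
Proof.
move=> [|n] // /andP[_ leN].
rewrite !quasi_diff_sl_solution //= ?(ltnW leN) // /y /=.
case: (sl_solution omega a b n) => p u /=.
set p' := p + _; rewrite hornerD hornerM hornerD hornerN hornerZ hornerC hornerX.
by rewrite addrAC subrr add0r mulrBl opprB subrK (mulrC lambda).
Qed.

Lemma sl_solution_uniq (z : nat -> C) :
  sl_equation omega lambda z -> z 0%N = a -> quasi_diff omega z 0%N = b ->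
  forall n, (n <= N.+1)%N -> z n = y n.
Proof.
move=> zP z0 z'0.
have zS n : (n <= N)%N -> z n.+1 = z n + (sl_f omega n)^-1 * quasi_diff omega z n.
  move=> leNn; rewrite /quasi_diff mulrA mulVf ?sl_f_neq0 // mul1r.
  by rewrite addrC subrK.
have yS n : (n <= N)%N -> y n.+1 = y n + (sl_f omega n)^-1 * quasi_diff omega y n.
  move=> leNn; rewrite /quasi_diff mulrA mulVf ?sl_f_neq0 // mul1r.
  by rewrite addrC subrK.
have eqz n : (n <= N)%N ->
    z n = y n /\ quasi_diff omega z n = quasi_diff omega y n.
  elim: n => [_|n IHn ltnN]; first by have [-> ->] := sl_solution0.
  have [IH1 IH2] := IHn (ltnW ltnN).
  have e1 : z n.+1 = y n.+1 by rewrite zS ?yS ?IH1 ?IH2 // ltnW.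
  split=> //; have := zP n.+1 ltnN; have := @sl_solutionP n.+1 ltnN.
  by rewrite /= e1 IH2 => <- /addIr/oppr_inj/addIr.
case=> [_|n leN]; first by have [-> _] := eqz 0%N isT.
by rewrite zS // yS //; have [-> ->] := eqz n leN.
Qed.

End SolutionSpec.

Lemma horner_Phi omega lambda (i j : 'I_2) :
  (Phi omega i j).[lambda] =
  sl_state omega
    (fun n => (sl_solution omega (j == 0)%:R (j != 0)%:R n).1.[lambda]) N i 0.
Proof.
rewrite !mxE; case: ifP => _; case: ifP => _ //=.
- by rewrite (quasi_diff_sl_solution _ _ 1 0).
- by rewrite (quasi_diff_sl_solution _ _ 0 1).
Qed.

End Equation.

Section BoundaryCondition.
Variable R : realType.
Local Notation C := R[i].

Definition bc_set :=
  [set AB : 'M[C]_2 * 'M[C]_2 | \rank (row_mx AB.1 AB.2) = 2%N].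

Definition bc_rep : Type := set_type bc_set.
HB.instance Definition _ := Choice.copy bc_rep (set_type bc_set).
HB.instance Definition _ := Topological.copy bc_rep (set_type bc_set).

Definition bc_equiv (X Y : bc_rep) : bool :=
  `[< exists2 T : 'M[C]_2, T \in unitmx &
        val Y = (T *m (val X).1, T *m (val X).2) >].

Lemma bc_equiv_refl : reflexive bc_equiv.
Proof.
by move=> X; apply/asboolP; exists 1%:M; rewrite ?unitmx1 // !mul1mx; case: (val X).
Qed.

Lemma bc_equiv_sym : symmetric bc_equiv.
Proof.
suff sym X Y : bc_equiv X Y -> bc_equiv Y X by move=> X Y; apply/idP/idP; exact: sym.
move=> /asboolP[T uT eY]; apply/asboolP; exists (invmx T); first by rewrite unitmx_inv.
by rewrite eY /= !mulKmx //; case: (val X).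
Qed.

Lemma bc_equiv_trans : transitive bc_equiv.
Proof.
move=> Y X Z /asboolP[T uT eY] /asboolP[T' uT' eZ]; apply/asboolP.
by exists (T' *m T); rewrite ?unitmx_mul ?uT ?uT' // eZ eY /= !mulmxA.
Qed.

Canonical bc_equiv_equivRel :=
  EquivRel bc_equiv bc_equiv_refl bc_equiv_sym bc_equiv_trans.

(* The space of boundary conditions [A | B], with the quotient topology. *)
Definition bc_space : Type := quotient_topology {eq_quot bc_equiv}.
HB.instance Definition _ :=
  Topological.copy bc_space (quotient_topology {eq_quot bc_equiv}).
HB.instance Definition _ :=
  Quotient.copy bc_space (quotient_topology {eq_quot bc_equiv}).

Lemma bc_repr_pi (X : bc_rep) : bc_equiv (repr (\pi_bc_space X)) X.
Proof. by rewrite -eqmodE; apply/eqP; exact: (reprK (\pi_bc_space X)). Qed.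

End BoundaryCondition.

Section Problem.
Variables (R : realType) (N : nat).
Local Notation C := R[i].
Implicit Types (omega : Omega R N) (X : bc_rep R) (A : bc_space R) (lambda : C).

Definition bc_holds omega X (y : nat -> C) : Prop :=
  (val X).1 *m sl_state omega y 0 + (val X).2 *m sl_state omega y N = 0.

Definition eigenvalue_rep omega X lambda : Prop :=
  exists y : nat -> C,
    [/\ exists2 n, (n <= N.+1)%N & y n != 0,
        sl_equation omega lambda y & bc_holds omega X y].

Definition Gamma_rep omega X : {poly C} :=
  \det (map_mx polyC (val X).1 + map_mx polyC (val X).2 *m Phi omega).

Definition sl_eigenvalue omega A lambda : Prop :=
  eigenvalue_rep omega (repr A) lambda.

(* mup lambda p is the order of lambda as a zero of a nonzero polynomial p;
   it is not meaningful if p = 0, in which case every lambda is an eigenvalue. *)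
Definition multiplicity omega A lambda : nat :=
  mup lambda (Gamma_rep omega (repr A)).

Lemma bc_holds_equiv omega X Y y :
  bc_equiv X Y -> bc_holds omega X y <-> bc_holds omega Y y.
Proof.
move=> /asboolP[T uT eY]; rewrite /bc_holds eY /= -!mulmxA -mulmxDr.
split=> [->|/(congr1 (mulmx (invmx T)))]; first by rewrite mulmx0.
by rewrite mulKmx // mulmx0.
Qed.

Lemma sl_eigenvalue_pi omega X lambda :
  sl_eigenvalue omega (\pi_(bc_space R) X) lambda <->
  eigenvalue_rep omega X lambda.
Proof.
by split=> -[y [y0 yP yX]]; exists y; split=> //;
  apply/(bc_holds_equiv omega y (bc_repr_pi X)).
Qed.

Lemma Gamma_rep_equiv omega X Y : bc_equiv X Y ->
  exists2 c : C, c != 0 & Gamma_rep omega Y = c *: Gamma_rep omega X.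
Proof.
move=> /asboolP[T uT eY]; exists (\det T); first by rewrite -unitfE -unitmxE.
rewrite /Gamma_rep eY /= !map_mxM -mulmxA -mulmxDr det_mulmx det_map_mx.
by rewrite mul_polyC.
Qed.

Lemma multiplicity_pi omega X lambda :
  multiplicity omega (\pi_(bc_space R) X) lambda
  = mup lambda (Gamma_rep omega X).
Proof.
have [c c0 ->] := Gamma_rep_equiv omega (bc_repr_pi X).
by rewrite /multiplicity -mul_polyC mupMr // rootC.
Qed.

(* The list s enumerates without repetition the eigenvalues in E. *)
Definition eigenvalue_count omega A (E : set C) (m : nat) : Prop :=
  exists s : seq C,
    [/\ uniq s,
        forall z, z \in s <-> E z /\ sl_eigenvalue omega A z &
        (\sum_(z <- s) multiplicity omega A z)%N = m].

End Problem.

(* Main.v *)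
Require Import Defs.
From mathcomp Require Import all_boot all_order all_algebra complex.
From mathcomp Require Import all_classical all_reals topology normedtype.
From mathcomp Require Import ring.

Set Implicit Arguments.
Unset Strict Implicit.
Unset Printing Implicit Defensive.

Import Order.TTheory GRing.Theory Num.Theory.
Import numFieldNormedType.Exports.

Local Open Scope classical_set_scope.
Local Open Scope ring_scope.
Local Open Scope complex_scope.

(** The eigenvalues of a problem are the zeros of the characteristic polynomial
    [Gamma_rep] (lemma [root_Gamma_rep]), which also defines their multiplicities,
    so the theorem says that the zeros of a polynomial move continuously with the
    problem.

    The coefficients of [Gamma_rep] are polynomials in the parameters: the
    coordinates on the space of equations are the [1/f_n], [q_n], [w_n], and only
    these enter the recursion defining the solutions.  The degree is bounded by a
    constant, but it may be smaller at the given problem than at its neighbours,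
    whose additional zeros then come in from infinity; a bounded domain does not
    see them.  The polynomial of the given problem is not zero, because otherwise
    every point of the open set [D] would be an eigenvalue.

    Stability of zeros ([near_splits_in]) is proved without contour integrals, by
    induction on the number of zeros in the domain.  If there is none, the
    polynomial does not vanish on a compact set, and neither do its neighbours.
    Otherwise let [l] be a zero.  Every nearby polynomial has a zero [z] near [l]
    ([near_root]): if all its zeros were at distance at least [d] from [l], its
    value at any other point would be controlled by its value at [l], which is
    small ([horner_le_far_roots]).  Dividing by ['X - z%:P] gives a polynomial
    whose coefficients are continuous in the parameter and [z] jointly, and the
    induction hypothesis applies to it.

    The topology of the space of boundary conditions is a quotient topology.  The
    projection from the pairs [(A, B)] is open, being the quotient by a group
    acting by homeomorphisms ([bc_pi_open]), so a neighbourhood found for a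
    representative descends to the quotient, also after taking the product with
    the space of equations ([near_problem]). *)

(** * Polynomials with continuous coefficients *)

(** Coefficientwise continuity alone does not control the zeros: a zero can come
    in from infinity as soon as the degree is unbounded.  The uniform bound on
    the sizes still lets the degree drop at [t0]. *)
Definition poly_continuous_at (K : numFieldType) (T : topologicalType)
    (t0 : T) (p : T -> {poly K}) :=
  (exists M, forall t, (size (p t) <= M)%N) /\
  (forall i, continuous_at t0 (fun t => (p t)`_i)).

Lemma continuous_at_sum (K : numFieldType) (T : topologicalType) (I : Type)
    (r : seq I) (P : pred I) (f : I -> T -> K) (t0 : T) :
  (forall i, P i -> continuous_at t0 (f i)) ->
  continuous_at t0 (fun t => \sum_(i <- r | P i) f i t).
Proof.
move=> cf; elim: r => [|i r IH].
  by rewrite (eq_fun (fun t => big_nil _ _ _ _)); exact: cvg_cst.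
under eq_fun do rewrite big_cons.
case: (boolP (P i)) => Pi //; apply: (cvgD _ IH); exact: cf.
Qed.

Lemma continuous_at_exp (K : numFieldType) (T : topologicalType)
    (f : T -> K) (n : nat) (t0 : T) :
  continuous_at t0 f -> continuous_at t0 (fun t => f t ^+ n).
Proof.
move=> cf; elim: n => [|n IH]; first exact: cvg_cst.
by under eq_fun do rewrite exprS; exact: cvgM.
Qed.

Lemma continuous_at_mul (K : numFieldType) (T : topologicalType)
    (f g : T -> K) (t0 : T) : continuous_at t0 f -> continuous_at t0 g ->
  continuous_at t0 (fun t => f t * g t).
Proof. by move=> cf cg; exact: cvgM. Qed.

Section PolyContinuous.
Variables (K : numFieldType) (T : topologicalType) (t0 : T).
Implicit Types (p q : T -> {poly K}) (f : T -> K).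
Local Notation pcont := (@poly_continuous_at K T t0).

Lemma eq_poly_continuous p q : p =1 q -> pcont q -> pcont p.
Proof. by move=> /funext ->. Qed.

Lemma poly_continuous_cst (c : {poly K}) : pcont (fun=> c).
Proof. by split=> [|i]; [exists (size c)|exact: cvg_cst]. Qed.

Lemma poly_continuous_polyC f : continuous_at t0 f -> pcont (fun t => (f t)%:P).
Proof.
move=> cf; split=> [|i]; first by exists 1%N => t; exact: size_polyC_leq1.
rewrite (funext (fun t => coefC (f t) i)).
by case: eqP => _ //; exact: cvg_cst.
Qed.

Lemma poly_continuous_add p q : pcont p -> pcont q -> pcont (fun t => p t + q t).
Proof.
move=> [[M szp] cp] [[M' szq] cq]; split=> [|i].
  exists (maxn M M') => t; rewrite (leq_trans (size_polyD _ _)) //.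
  by rewrite geq_max !leq_max szp szq orbT.
rewrite (funext (fun t => coefD (p t) (q t) i)).
by apply: cvgD; [exact: cp|exact: cq].
Qed.

Lemma poly_continuous_mul p q : pcont p -> pcont q -> pcont (fun t => p t * q t).
Proof.
move=> [[M szp] cp] [[M' szq] cq]; split=> [|i].
  exists (M + M')%N => t; rewrite (leq_trans (size_polyMleq _ _)) //.
  by rewrite (leq_trans (leq_pred _)) // leq_add.
rewrite (funext (fun t => coefM (p t) (q t) i)).
by apply: continuous_at_sum => j _; apply: continuous_at_mul; [exact: cp|exact: cq].
Qed.

Lemma poly_continuous_sum (I : Type) (r : seq I) (F : I -> T -> {poly K}) :
  (forall i, pcont (F i)) -> pcont (fun t => \sum_(i <- r) F i t).
Proof.
move=> cF; elim: r => [|i r IH].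
  by rewrite (funext (fun t => big_nil _ _ _ _)); exact: poly_continuous_cst.
rewrite (funext (fun t => big_cons _ _ _ _ _ _)) /=.
exact: poly_continuous_add.
Qed.

Lemma poly_continuous_prod (I : Type) (r : seq I) (F : I -> T -> {poly K}) :
  (forall i, pcont (F i)) -> pcont (fun t => \prod_(i <- r) F i t).
Proof.
move=> cF; elim: r => [|i r IH].
  by rewrite (funext (fun t => big_nil _ _ _ _)); exact: poly_continuous_cst.
rewrite (funext (fun t => big_cons _ _ _ _ _ _)) /=.
exact: poly_continuous_mul.
Qed.

Lemma poly_continuous_det n (A : T -> 'M[{poly K}]_n) :
  (forall i j, pcont (fun t => A t i j)) -> pcont (fun t => \det (A t)).
Proof.
move=> cA; apply: poly_continuous_sum => s; apply: poly_continuous_mul.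
  exact: poly_continuous_cst.
by apply: poly_continuous_prod => i; exact: cA.
Qed.

Lemma horner_continuous_at p f : pcont p -> continuous_at t0 f ->
  continuous_at t0 (fun t => (p t).[f t]).
Proof.
move=> [[M szp] cp] cf.
rewrite (funext (fun t => horner_coef_wide (f t) (szp t))).
apply: continuous_at_sum => i _; apply: continuous_at_mul; first exact: cp.
exact: continuous_at_exp.
Qed.

End PolyContinuous.

(** * Stability of the zeros of a polynomial *)

Section Deformation.
Variable K : numClosedFieldType.

(** Each linear factor of [p] satisfies
    [`|z - w| <= `|l - w| + `|z - l| <= `|l - w| * (1 + `|z - l| / d)]. *)
Lemma horner_le_far_roots (p : {poly K}) (l d : K) :
  0 < d -> (forall w, root p w -> d <= `|l - w|) ->
  forall z, `|p.[z]| <= `|p.[l]| * (1 + `|z - l| / d) ^+ size p.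
Proof.
move=> d0 far z; have [r Ep] := closed_field_poly_normal p.
have [->|p0] := eqVneq p 0; first by rewrite !horner0 normr0 mul0r.
have lc0 : lead_coef p != 0 by rewrite lead_coef_eq0.
have szr : (size r <= size p)%N.
  by rewrite Ep size_scale // size_prod_XsubC.
set C := 1 + _; have C1 : 1 <= C by rewrite lerDl divr_ge0 // (ltW d0).
apply: (@le_trans _ _ (`|p.[l]| * C ^+ size r)); last first.
  by apply: ler_wpM2l => //; exact: ler_weXn2l.
have {}far w : w \in r -> d <= `|l - w|.
  by move=> wr; apply: far; rewrite Ep rootZ // root_prod_XsubC.
rewrite Ep !hornerZ !normrM -mulrA ler_wpM2l //.
elim: r far {Ep szr} => [|w r IH] far; first by rewrite !big_nil !hornerC expr0 mulr1.
rewrite !big_cons !hornerM !hornerXsubC !normrM exprS mulrACA.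
apply: ler_pM => //; last by apply: IH => v vr; apply: far; rewrite inE vr orbT.
have dw : d <= `|l - w| by apply: far; rewrite mem_head.
have -> : z - w = (l - w) + (z - l) by ring.
apply: (le_trans (ler_normD _ _)); rewrite mulrDr mulr1 lerD2l.
by rewrite mulrA ler_pdivlMr // mulrC ler_wpM2r.
Qed.

(** Otherwise there are arbitrarily close [t] such that all zeros of [p t] stay
    away from [l]; then [(p t).[l]], which tends to [0], bounds [(p t).[z1]] for a
    point [z1] with [(p t0).[z1] != 0]. *)
Lemma near_root (T : topologicalType) (p : T -> {poly K}) (t0 : T) (l : K)
    (V : set K) :
  poly_continuous_at t0 p -> p t0 != 0 -> root (p t0) l -> nbhs l V ->
  \forall t \near t0, exists2 z, root (p t) z & V z.
Proof.
move=> cp /closed_nonrootP[z1 pz1] /rootP pl /nbhs_ballP[d /= d0 dV].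
have [[M szp] _] := cp.
have cev z : continuous_at t0 (fun t => (p t).[z]).
  by apply: (horner_continuous_at cp); exact: cvg_cst.
(* C does not depend on t: this is where the bound M on the degrees is used. *)
pose C := (1 + `|z1 - l| / d) ^+ M; pose a := `|(p t0).[z1]| / 2.
have C0 : 0 < C by rewrite exprn_gt0 // ltr_pwDl // divr_ge0 // (ltW d0).
have a0 : 0 < a by rewrite divr_gt0 // normr_gt0.
have near1 : \forall t \near t0, `|(p t0).[z1] - (p t).[z1]| < a.
  by have /cvgrPdist_lt := cev z1; exact.
have near2 : \forall t \near t0, `|(p t0).[l] - (p t).[l]| < a / C.
  by have /cvgrPdist_lt := cev l; apply; rewrite divr_gt0.
near=> t; apply: contrapT => noroot.
have far w : root (p t) w -> d <= `|l - w|.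
  move=> rw; rewrite real_leNgt ?normr_real ?gtr0_real //; apply/negP => lw.
  by apply: noroot; exists w => //; exact: dV.
have /(_ z1) := horner_le_far_roots d0 far.
have lt1 : `|(p t0).[z1] - (p t).[z1]| < a by near: t.
have lt2 : `|(p t).[l]| < a / C by rewrite -normrN -sub0r -pl; near: t.
apply/negP; rewrite -real_ltNge ?ger0_real //; last first.
  by rewrite mulr_ge0 // exprn_ge0 // addr_ge0 // divr_ge0 // (ltW d0).
have Ct : (1 + `|z1 - l| / d) ^+ size (p t) <= C.
  by apply: ler_weXn2l => //; rewrite lerDl divr_ge0 // (ltW d0).
apply: (le_lt_trans (ler_wpM2l _ Ct)) => //.
rewrite -ltr_pdivlMr //; apply: (lt_le_trans lt2).
rewrite ler_pM2r ?invr_gt0 //.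
have : `|(p t0).[z1]| <= `|(p t0).[z1] - (p t).[z1]| + `|(p t).[z1]|.
  by rewrite -{1}[(p t0).[z1]](subrK (p t).[z1]) ler_normD.
have -> : `|(p t0).[z1]| = a + a by rewrite /a -splitr.
move=> le2; rewrite -(lerD2l a); apply: (le_trans le2).
by rewrite lerD2r ltW.
Unshelve. all: end_near. Qed.

(** The quotient of [p - p.[z]%:P] by ['X - z%:P], in closed form: unlike Euclidean
    division, it is visibly a polynomial in [z] and the coefficients of [p].  The
    bound [M] replaces [size p], which is not a continuous function of [p]. *)
Definition deflate (M : nat) (p : {poly K}) (z : K) : {poly K} :=
  \sum_(i < M) p`_i *: \sum_(j < i) 'X^(i.-1 - j) * (z ^+ j)%:P.

Lemma deflateE (M : nat) (p : {poly K}) (z : K) : (size p <= M)%N ->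
  p = p.[z]%:P + ('X - z%:P) * deflate M p z.
Proof.
move=> szp; rewrite (horner_coef_wide _ szp) rmorph_sum mulr_sumr -big_split /=.
rewrite -{1}[p]coefK poly_def (big_ord_widen M (fun i => p`_i *: 'X^i)) //.
rewrite big_mkcond; apply: eq_bigr => i _ /=.
under [\sum_(j < i) _]eq_bigr do rewrite polyC_exp.
rewrite -scalerAr -subrXX polyCM polyC_exp -mul_polyC /=.
case: ltnP => [_|/(nth_default 0) ->]; last by rewrite !(polyC0, scale0r, mul0r, addr0).
by rewrite -mul_polyC -mulrDr addrC subrK.
Qed.

Lemma size_deflate (M : nat) (p : {poly K}) (z : K) : (size (deflate M p z) <= M)%N.
Proof.
rewrite (leq_trans (size_sum _ _ _)) //; apply/bigmax_leqP => i _.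
rewrite (leq_trans (size_scale_leq _ _)) // (leq_trans (size_sum _ _ _)) //.
apply/bigmax_leqP => j _; rewrite mulrC mul_polyC (leq_trans (size_scale_leq _ _)) //.
rewrite size_polyXn (leq_trans _ (ltn_ord i)) // ltnS.
by rewrite (leq_trans (leq_subr _ _)) ?leq_pred.
Qed.

Lemma deflate_continuous (T : topologicalType) (p : T -> {poly K}) (t0 : T)
    (M : nat) (l : K) :
  poly_continuous_at t0 p ->
  poly_continuous_at (t0, l) (fun x : T * K => deflate M (p x.1) x.2).
Proof.
move=> [_ cp]; split=> [|k].
  by exists M => x; exact: size_deflate.
rewrite [X in continuous_at _ X](_ : _ = fun x => \sum_(i < M)
  (p x.1)`_i * \sum_(j < i) ('X^(i.-1 - j) : {poly K})`_k * x.2 ^+ j).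
  apply: continuous_at_sum => i _; apply: continuous_at_mul.
    by apply: (@continuous_comp _ _ _ fst (fun t => (p t)`_i));
      [exact: cvg_fst|exact: cp].
  apply: continuous_at_sum => j _; apply: continuous_at_mul.
    exact: cvg_cst.
  by apply: continuous_at_exp; exact: cvg_snd.
apply/funext => x; rewrite coef_sum; apply: eq_bigr => i _.
by rewrite coefZ coef_sum; under eq_bigr do rewrite coefMC.
Qed.

(** For [U `<=` E]: [p] has [m] zeros in [E], with multiplicity, and they lie in
    [U].  Stating this as a factorization makes removing one zero immediate. *)
Definition splits_in (U E : set K) (m : nat) (p : {poly K}) : Prop :=
  exists q s, [/\ p = q * \prod_(z <- s) ('X - z%:P), size s = m,
    forall z, z \in s -> U z & forall z, E z -> ~~ root q z].

(** The induction on [s] is uniform in the parameter space: after one zero has been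
    divided out, the parameter is the pair of [t] and that zero, so the induction
    hypothesis is used on [T * K]. *)
Lemma near_splits_in (U E : set K) (s : seq K) (q : {poly K})
    (T : topologicalType) (p : T -> {poly K}) (t0 : T) :
  compact E -> open U -> poly_continuous_at t0 p ->
  p t0 = q * \prod_(z <- s) ('X - z%:P) -> q != 0 ->
  (forall z, z \in s -> U z) -> (forall z, E z -> ~~ root q z) ->
  \forall t \near t0, splits_in U E (size s) (p t).
Proof.
move=> cE oU; elim: s T p t0 => [|l s IH] T p t0 cp Ep q0 sU qE.
  rewrite big_nil mulr1 in Ep.
  suff : \forall t \near t0, E `<=` (fun z => ~~ root (p t) z).
    apply: filterS => t nr; exists (p t), [::]; split=> //.
    by rewrite big_nil mulr1.
  (* Nonvanishing is an open condition on (z, t), and E is compact. *)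
  have /compact_near_coveringP := cE; apply => z Ez.
  have cev : continuous_at (z, t0) (fun x : K * T => (p x.2).[x.1]).
    apply: horner_continuous_at; last exact: cvg_fst.
    have [[M szp] {}cp] := cp; split=> [|i]; first by exists M.
    apply: (@continuous_comp _ _ _ snd (fun t => (p t)`_i)); last exact: cp.
    exact: cvg_snd.
  have pz0 : (p t0).[z] != 0 by rewrite Ep; exact: qE.
  by have /cvgr_neq0 := cev; apply.
have Ul : U l by apply: sU; rewrite mem_head.
have pl : (p t0).[l] = 0.
  by rewrite Ep big_cons !hornerM hornerXsubC subrr mul0r mulr0.
have [[M szp] _] := cp.
have Edef : deflate M (p t0) l = q * \prod_(z <- s) ('X - z%:P).
  apply: (@mulfI _ ('X - l%:P)); first by rewrite polyXsubC_eq0.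
  have := deflateE l (szp t0); rewrite pl polyC0 add0r => <-.
  by rewrite Ep big_cons mulrCA.
have p0 : p t0 != 0.
  by rewrite Ep mulf_neq0 // monic_neq0 // monic_prod_XsubC.
have := IH _ (fun x => deflate M (p x.1) x.2) (t0, l)
  (deflate_continuous M l cp) Edef q0.
case=> [z zs|//|[A B] [/= At0 Bl] AB]; first by apply: sU; rewrite inE zs orbT.
(* A and B are the neighbourhoods of t0 and l given by the induction hypothesis. *)
near=> t.
have [z /rootP rz [Bz Uz]] : exists2 z, root (p t) z & (B `&` U) z.
  near: t; apply: (near_root cp p0 (l := l)); first exact/rootP.
  by apply: filterI => //; exact: open_nbhs_nbhs.
have [|q' [s' [Eq szs s'U q'E]]] := AB (t, z).
  by split=> //=; near: t.
exists q', (z :: s'); split=> //=; last 2 first.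
- by rewrite szs.
- by move=> w; rewrite inE => /predU1P[->//|]; exact: s'U.
by rewrite (deflateE z (szp t)) rz polyC0 add0r Eq big_cons mulrCA.
Unshelve. all: end_near. Qed.

Lemma splits_in_count (U E : set K) (m : nat)
    (p : {poly K}) : E !=set0 -> U `<=` E -> splits_in U E m p ->
  exists s, [/\ uniq s, forall z, z \in s <-> E z /\ root p z,
    (\sum_(z <- s) mup z p)%N = m & forall z, E z -> root p z -> U z].
Proof.
move=> [e Ee] UE [q [s [-> szs sU qE]]].
have q0 : q != 0 by apply: contraNneq (qE e Ee) => ->; rewrite root0.
have rootE z : E z -> root (q * \prod_(z <- s) ('X - z%:P)) z = (z \in s).
  by move=> Ez; rewrite rootM root_prod_XsubC (negbTE (qE z Ez)).
exists (undup s); split=> [|z||z Ez]; first exact: undup_uniq.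
- rewrite mem_undup; split=> [zs|[Ez]]; last by rewrite rootE.
  by have Ez := UE _ (sU _ zs); rewrite rootE.
- rewrite -szs -sum1_size -[RHS]big_undup_iterop_count.
  apply: eq_big_seq => z; rewrite mem_undup => zs.
  rewrite mupMr ?mu_prod_XsubC; last exact/qE/UE/sU.
  by rewrite Monoid.iteropE iter_addn_0 mul1n.
by rewrite rootE // => /sU.
Qed.

End Deformation.

(** * Bounded sets of complex numbers *)

Section ComplexCompactness.
Variable R : realType.
Local Notation C := R[i].

Lemma real_complex_continuous : continuous (fun x : R => x%:C : C).
Proof.
move=> x; apply/cvgrPdist_lt => e e0.
have eE : e = (complex.Re e)%:C by rewrite RRe_real // gtr0_real.
have Re0 : 0 < complex.Re e by rewrite -ltcR -eE.
near=> t; rewrite -rmorphB /= normc_def /= expr0n addr0 sqrtr_sqr eE ltcR.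
by near: t; exact: cvgr_dist_lt.
Unshelve. all: end_near. Qed.

(** The square [[- r, r] x [- r, r]] of the plane is compact, and so is its image
    under [(a, b) |-> a + ib]. *)
Lemma compact_closure_bounded (D : set C) : bounded_set D -> compact (closure D).
Proof.
case=> M [Mr DM].
pose r := complex.Re (M + 1).
have Dr z : D z -> `|complex.Re z| <= r /\ `|complex.Im z| <= r.
  move=> Dz; have : `|z| <= M + 1 by apply: DM => //; rewrite ltrDl.
  have -> : M + 1 = r%:C by rewrite /r RRe_real // realD // real1.
  rewrite normc_def lecR => zr; split; apply: le_trans zr.
    by rewrite -sqrtr_sqr ler_wsqrtr // lerDl sqr_ge0.
  by rewrite -sqrtr_sqr ler_wsqrtr // lerDr sqr_ge0.
pose f (x : R * R) : C := x.1%:C + 'i%C * x.2%:C.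
have cf : continuous f.
  move=> x; apply: (@cvgD _ C); last apply: (@cvgM _ _ _ _ (fun=> 'i%C)); first 2 last.
  - apply: (@continuous_comp _ _ _ snd (fun x : R => x%:C : C)); first exact: cvg_snd.
    exact: real_complex_continuous.
  - apply: (@continuous_comp _ _ _ fst (fun x : R => x%:C : C)); first exact: cvg_fst.
    exact: real_complex_continuous.
  - exact: cvg_cst.
pose B : set C := f @` (`[- r, r] `*` `[- r, r]).
have cB : compact B.
  apply: continuous_compact; first exact: continuous_subspaceT.
  by apply: compact_setX; exact: segment_compact.
apply: (subclosed_compact _ cB); first exact: closed_closure.
have /closure_id -> : closed B by apply: compact_closed => //; exact: norm_hausdorff.
apply: closure_subset => z /Dr[re im].
exists (complex.Re z, complex.Im z); last by rewrite /f /= -complexE.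
by split; rewrite /= in_itv /= -ler_norml.
Qed.

End ComplexCompactness.

(** * Eigenvalues as zeros of the characteristic polynomial *)

Section Eigenvalues.
Variables (R : realType) (N : nat).
Implicit Types (omega : Omega R N) (X : bc_rep R) (l : R[i]).

Lemma sl_solution_linear omega a b n :
  sl_solution omega a b n =
  (a *: (sl_solution omega 1 0 n).1 + b *: (sl_solution omega 0 1 n).1,
   a *: (sl_solution omega 1 0 n).2 + b *: (sl_solution omega 0 1 n).2).
Proof.
elim: n => [|n IH] /=.
  by rewrite polyC1 polyC0 !scaler0 addr0 add0r !alg_polyC.
rewrite IH; case: (sl_solution omega 1 0 n) => y u.
case: (sl_solution omega 0 1 n) => y' u' /=.
by rewrite -!mul_polyC; congr pair; ring.
Qed.

(** The transfer matrix from [0] to [N] is the value of [Phi] at [l]. *)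
Lemma sl_state_propagate omega l (y : nat -> R[i]) : sl_equation omega l y ->
  sl_state omega y N = map_mx (horner_eval l) (Phi omega) *m sl_state omega y 0.
Proof.
move=> yP; apply/matrixP => i j; rewrite !mxE big_ord_recl big_ord1 !mxE /=.
(* The initial values get names so that rewriting with yE terminates. *)
move: (erefl (quasi_diff omega y 0)) (erefl (y 0%N)).
move: {1 3}(quasi_diff omega y 0) {1 3}(y 0%N) => b a y'0 y0.
have yE n : (n <= N.+1)%N -> y n = (sl_solution omega a b n).1.[l].
  exact: sl_solution_uniq.
rewrite /horner_eval; case: ifP => _; last first.
  have -> : quasi_diff omega y N = (sl_solution omega a b N).2.[l].
    by rewrite -quasi_diff_sl_solution // /quasi_diff !yE.
  by rewrite sl_solution_linear hornerD !hornerZ mulrC; congr (_ + _); exact: mulrC.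
by rewrite yE // sl_solution_linear hornerD !hornerZ mulrC; congr (_ + _); exact: mulrC.
Qed.

Lemma horner_Gamma_rep omega X l : (Gamma_rep omega X).[l] =
  \det ((val X).1 + (val X).2 *m map_mx (horner_eval l) (Phi omega)).
Proof.
have cK (Z : 'M[R[i]]_2) : map_mx (horner_eval l) (map_mx polyC Z) = Z.
  by apply/matrixP => i j; rewrite !mxE /= /horner_eval hornerC.
rewrite -[LHS]/(horner_eval l _) /Gamma_rep -det_map_mx map_mxD map_mxM.
by rewrite !cK.
Qed.

(** By [sl_state_propagate] the boundary condition is a linear system of two
    equations in the initial state, and a solution is nonzero exactly when its
    initial state is. *)
Lemma root_Gamma_rep omega X l :
  root (Gamma_rep omega X) l <-> eigenvalue_rep omega X l.
Proof.
have bcE y : sl_equation omega l y -> bc_holds omega X y <->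
    ((val X).1 + (val X).2 *m map_mx (horner_eval l) (Phi omega))
      *m sl_state omega y 0 = 0.
  by move=> yP; rewrite /bc_holds (sl_state_propagate yP) mulmxDl mulmxA.
rewrite rootE horner_Gamma_rep; split.
  rewrite -det_tr => /det0P[v v0 /(congr1 trmx)].
  rewrite trmx_mul trmxK trmx0 => vM.
  pose y n := (sl_solution omega (v 0 0) (v 0 1) n).1.[l].
  have yP : sl_equation omega l y by exact: sl_solutionP.
  have [y0 y1] : y 0%N = v 0 0 /\ quasi_diff omega y 0 = v 0 1.
    exact: sl_solution0.
  have vE : sl_state omega y 0 = v^T.
    apply/matrixP => i j; rewrite !mxE ord1 y0 y1.
    case: ifP => [/eqP->|/negbT]//; case: i => -[|[|//]] ? // _.
    by congr (v _ _); apply: val_inj.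
  exists y; split=> //; last by apply/(bcE _ yP); rewrite vE.
  apply: contrapT => ally; move/eqP: v0; apply; apply: trmx_inj; rewrite -vE.
  have y_0 n : (n <= N.+1)%N -> y n = 0.
    by move=> nN; apply/eqP; apply: contrapT => /negP yn; apply: ally; exists n.
  apply/matrixP => i j; rewrite !mxE /quasi_diff !y_0 // subrr mulr0.
  by case: ifP.
case=> y [[n nN yn0] yP /(bcE _ yP) My].
rewrite -det_tr; apply/det0P; exists (sl_state omega y 0)^T; last first.
  by rewrite -trmx_mul My trmx0.
apply/eqP => /(congr1 trmx)/matrixP; rewrite trmxK trmx0 => s0.
have := s0 0 0; have := s0 1 0; rewrite !mxE /= => q0 y0.
move: yn0; rewrite (sl_solution_uniq yP y0 q0 nN) sl_solution_linear.
by rewrite !scale0r addr0 horner0 eqxx.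
Qed.

End Eigenvalues.

(** * Continuous dependence of the characteristic polynomial *)

Section GammaContinuity.
Variables (R : realType) (N : nat).
Local Notation C := R[i].
Variables (T : topologicalType) (t0 : T).
Variables (om : T -> Omega R N) (X : T -> bc_rep R).
Hypothesis om_cont : continuous_at t0 om.
Hypothesis X_cont : continuous_at t0 X.

Lemma entry_continuous k (v : T -> 'rV[C]_k) n :
  continuous_at t0 v -> continuous_at t0 (fun t => entry (v t) n).
Proof.
move=> cv; rewrite /entry; case: insubP => [i _ _|_]; last exact: cvg_cst.
apply: (@continuous_comp _ _ _ v (fun w : 'rV[C]_k => w 0 i)) => //.
exact: coord_continuous.
Qed.

Let val_om : continuous_at t0 (fun t => val (om t)).
Proof.
apply: (@continuous_comp _ _ _ om) => //; exact: initial_continuous.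
Qed.

Let val_X : continuous_at t0 (fun t => val (X t)).
Proof.
apply: (@continuous_comp _ _ _ X) => //; exact: initial_continuous.
Qed.

Lemma sl_solution_continuous a b n :
  poly_continuous_at t0 (fun t => (sl_solution (om t) a b n).1) /\
  poly_continuous_at t0 (fun t => (sl_solution (om t) a b n).2).
Proof.
(* sl_f is the inverse of a coordinate, so this is the coordinate itself. *)
have cr k : continuous_at t0 (fun t => (sl_f (om t) k)^-1).
  rewrite /sl_f (funext (fun t => invrK (entry (val (om t)).1.1 k))).
  apply: entry_continuous.
  apply: (@continuous_comp _ _ _ (fun t => (val (om t)).1) fst); last exact: cvg_fst.
  by apply: (@continuous_comp _ _ _ (fun t => val (om t)) fst) => //; exact: cvg_fst.
have cq k : continuous_at t0 (fun t => sl_q (om t) k).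
  apply: entry_continuous.
  apply: (@continuous_comp _ _ _ (fun t => (val (om t)).1) snd); last exact: cvg_snd.
  by apply: (@continuous_comp _ _ _ (fun t => val (om t)) fst) => //; exact: cvg_fst.
have cw k : continuous_at t0 (fun t => sl_w (om t) k).
  apply: entry_continuous.
  by apply: (@continuous_comp _ _ _ (fun t => val (om t)) snd) => //; exact: cvg_snd.
elim: n => [|n [IH1 IH2]]; first by split; exact: poly_continuous_cst.
have E1 t : (sl_solution (om t) a b n.+1).1 = (sl_solution (om t) a b n).1 +
    ((sl_f (om t) n)^-1)%:P * (sl_solution (om t) a b n).2.
  by rewrite /=; case: sl_solution => ? ? /=; rewrite mul_polyC.
have E2 t : (sl_solution (om t) a b n.+1).2 = (sl_solution (om t) a b n).2 +
    ((sl_q (om t) n.+1)%:P + (- 'X) * (sl_w (om t) n.+1)%:P)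
      * (sl_solution (om t) a b n.+1).1.
  by rewrite /=; case: sl_solution => ? ? /=; rewrite mulNr ['X * _]mulrC mul_polyC.
have c1 : poly_continuous_at t0 (fun t => (sl_solution (om t) a b n.+1).1).
  apply: (eq_poly_continuous E1); apply: (poly_continuous_add IH1).
  by apply: (poly_continuous_mul _ IH2); exact: poly_continuous_polyC.
split; first exact: c1.
apply: (eq_poly_continuous E2); apply: (poly_continuous_add IH2).
apply: (poly_continuous_mul _ c1); apply: poly_continuous_add.
  exact: poly_continuous_polyC.
apply: poly_continuous_mul; first exact: poly_continuous_cst.
exact: poly_continuous_polyC.
Qed.

Lemma Gamma_rep_continuous : poly_continuous_at t0 (fun t => Gamma_rep (om t) (X t)).
Proof.
have c1 i j : continuous_at t0 (fun t => (val (X t)).1 i j).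
  apply: (@continuous_comp _ _ _ (fun t => (val (X t)).1) (fun A : 'M[C]_2 => A i j)).
    by apply: (@continuous_comp _ _ _ (fun t => val (X t)) fst) => //; exact: cvg_fst.
  exact: coord_continuous.
have c2 i j : continuous_at t0 (fun t => (val (X t)).2 i j).
  apply: (@continuous_comp _ _ _ (fun t => (val (X t)).2) (fun A : 'M[C]_2 => A i j)).
    by apply: (@continuous_comp _ _ _ (fun t => val (X t)) snd) => //; exact: cvg_snd.
  exact: coord_continuous.
apply: poly_continuous_det => i j; under eq_fun do rewrite !mxE.
apply: poly_continuous_add; first by apply: poly_continuous_polyC; exact: c1.
apply: poly_continuous_sum => k; under eq_fun do rewrite !mxE.
apply: poly_continuous_mul; first by apply: poly_continuous_polyC; exact: c2.
have [s1 s2] := sl_solution_continuous 1 0 N.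
have [s3 s4] := sl_solution_continuous 0 1 N.
by case: (j == 0); case: (k == 0); [exact: s1|exact: s2|exact: s3|exact: s4].
Qed.

End GammaContinuity.

(** * The space of boundary conditions *)

Section BoundaryQuotient.
Variable R : realType.
Local Notation C := R[i].

Lemma continuous_mx (K : ptopologicalType) (T : topologicalType) m n
    (A : T -> 'M[K]_(m, n)) :
  (forall i j, continuous (fun t => A t i j)) -> continuous A.
Proof.
move=> cA t B [P AP sPB].
have : \forall s \near t, forall ij : 'I_m * 'I_n, P ij.1 ij.2 (A s ij.1 ij.2).
  apply: filter_forall => -[i j] /=; exact: cA.
by apply: filterS => s sP; apply: sPB => i j; exact: (sP (i, j)).
Qed.

Lemma mulmx_continuous (T : 'M[C]_2) : continuous (fun A : 'M[C]_2 => T *m A).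
Proof.
apply: continuous_mx => i j A.
rewrite [X in continuous_at _ X](_ : _ =
  fun B : 'M[C]_2 => \sum_k T i k * B k j); last first.
  by apply/funext => B; rewrite mxE.
apply: continuous_at_sum => k _.
apply: (@continuous_at_mul _ _ (fun=> T i k) (fun B : 'M[C]_2 => B k j)).
  exact: (@cst_continuous _ _ (T i k) A).
exact: coord_continuous.
Qed.

Lemma bc_set_mul (T : 'M[C]_2) (X : bc_rep R) : T \in unitmx ->
  @bc_set R (T *m (val X).1, T *m (val X).2).
Proof.
move=> uT; rewrite /bc_set /= -mul_mx_row.
rewrite eqmxMfull; last by rewrite row_full_unit.
exact: (set_mem (valP X)).
Qed.

Local Open Scope quotient_scope.

Lemma bc_pi_eq (X Y : bc_rep R) :
  \pi_(bc_space R) X = \pi_(bc_space R) Y <-> bc_equiv X Y.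
Proof.
rewrite -eqmodE; split=> [XY|/eqP XY]; last exact: XY.
by apply/eqP; exact: XY.
Qed.

(** The saturation of an open set is the union of its translates under [GL(2)],
    each of which is open. *)
Lemma bc_pi_open (W : set (bc_rep R)) : open W ->
  open ((fun X => \pi_(bc_space R) X) @` W).
Proof.
move=> [V oV <-].
pose act (T : 'M[C]_2) (M : 'M[C]_2 * 'M[C]_2) := (T *m M.1, T *m M.2).
have oact T : open (act T @^-1` V).
  suff /continuousP : continuous (act T) by apply.
  move=> M B [[B1 B2] /= [nB1 nB2] sB].
  exists (mulmx T @^-1` B1, mulmx T @^-1` B2).
    by split; exact: mulmx_continuous.
  by move=> Z [Z1 Z2]; apply: sB.
rewrite /open /= /quotient_open.
rewrite [X in open X](_ : _ =
  \bigcup_(T in [set T : 'M[C]_2 | T \in unitmx])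
    (val @^-1` (act T @^-1` V) : set (bc_rep R))).
  by apply: bigcup_open => T _; exists (act T @^-1` V).
apply/seteqP; split=> [X [Y VY /bc_pi_eq/asboolP[T uT eY]]|X [T uT VX]].
  exists (invmx T); rewrite /= ?unitmx_inv // /act eY /= !mulKmx //.
  by rewrite -surjective_pairing.
exists (SigSub (mem_set (bc_set_mul X uT))); first exact: VX.
apply/bc_pi_eq; rewrite bc_equiv_sym; apply/asboolP.
by exists T.
Qed.

(** The product of the identity with a quotient map need not be a quotient map;
    openness of the projection is what makes neighbourhoods descend. *)
Lemma near_problem (N : nat) (omega : Omega R N) (A : bc_space R)
    (P : Omega R N -> bc_rep R -> Prop) :
  (\forall x \near (omega, repr A), P x.1 x.2) ->
  \forall x \near (omega, A),
    exists2 X, \pi_(bc_space R)%qT X = x.2 & P x.1 X.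
Proof.
case=> -[V W] /= [nV nW] VW.
exists (V, (fun X => \pi_(bc_space R)%qT X) @` W°) => /=; last first.
  move=> [om' A'] /= [Vom' [X WX <-]]; exists X => //.
  by apply: (VW (om', X)); split=> //=; exact: interior_subset.
split=> //; apply: open_nbhs_nbhs; split; first exact/bc_pi_open/open_interior.
by exists (repr A); [exact: nbhs_singleton (nbhs_interior nW)|exact: reprK].
Qed.

End BoundaryQuotient.

(** * The theorem *)

Theorem theorem3p4 (R : realType) (N : nat) (hN : (2 <= N)%N)
  (omega : Omega R N) (A : bc_space R) (lambda : R[i]) (m : nat)
  (D : set R[i])
  (eig_lambda : sl_eigenvalue omega A lambda)
  (mult_lambda : multiplicity omega A lambda = m)
  (D_open : open D) (D_bounded : bounded_set D) (D_lambda : D lambda)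
  (only_lambda : forall z : R[i],
     closure D z -> sl_eigenvalue omega A z -> z = lambda) :
  exists2 U : set (Omega R N * bc_space R), nbhs (omega, A) U &
    forall (omega' : Omega R N) (A' : bc_space R), U (omega', A') ->
      eigenvalue_count omega' A' (closure D) m /\
      (forall z : R[i], closure D z -> sl_eigenvalue omega' A' z -> D z).
Proof.
pose Gam (x : Omega R N * bc_rep R) := Gamma_rep x.1 x.2.
(* Otherwise all of D, which has other points than lambda, consists of eigenvalues. *)
have Gam0 : Gam (omega, repr A) != 0.
  apply/eqP => G0.
  have all_eig z : sl_eigenvalue omega A z.
    by apply/root_Gamma_rep; rewrite -[Gamma_rep _ _]/(Gam (omega, repr A)) G0 root0.
  have /nbhs_ballP[e /= e0 eD] : nbhs lambda D by exact: open_nbhs_nbhs.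
  have De : D (lambda + e / 2).
    apply: eD; rewrite /ball /= opprD addNKr normrN gtr0_norm ?divr_gt0 //.
    by rewrite ltr_pdivrMr // ltr_pMr // ltr1n.
  have /eqP := only_lambda _ (subset_closure De) (all_eig _).
  by rewrite -subr_eq0 addrC addKr mulf_eq0 invr_eq0 pnatr_eq0 orbF gt_eqF.
have [k [q qz Gq]] := multiplicity_XsubC (Gam (omega, repr A)) lambda.
rewrite Gam0 /= in qz.
have km : k = m.
  rewrite -mult_lambda /multiplicity -[Gamma_rep _ _]/(Gam (omega, repr A)) Gq.
  by rewrite mupMr // mup_XsubCX eqxx.
have {}Gq : Gam (omega, repr A) = q * \prod_(z <- nseq m lambda) ('X - z%:P).
  by rewrite big_nseq iter_mulr_1 -km.
have q0 : q != 0 by apply: contraNneq qz => ->; rewrite root0.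
have qD z : closure D z -> ~~ root q z.
  move=> Dz; apply: contraNN qz => qz.
  by rewrite -(only_lambda z Dz) //; apply/root_Gamma_rep;
    rewrite -[Gamma_rep _ _]/(Gam (omega, repr A)) Gq rootM qz.
have cG : poly_continuous_at (omega, repr A) Gam.
  by apply: Gamma_rep_continuous; [exact: cvg_fst|exact: cvg_snd].
have sD z : z \in nseq m lambda -> D z by rewrite mem_nseq => /andP[_ /eqP ->].
have := near_splits_in (compact_closure_bounded D_bounded) D_open cG Gq q0 sD qD.
rewrite size_nseq => nGam; eexists.
  exact: (near_problem
    (P := fun om X => splits_in D (closure D) m (Gamma_rep om X)) nGam).
move=> omega' A' [X /= <-] /splits_in_count[||s [us sE sm sD']].
- by exists lambda; exact: subset_closure.
- exact: subset_closure.
split.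
  exists s; split=> // [z|]; first by rewrite sl_eigenvalue_pi -root_Gamma_rep.
  by rewrite -sm; apply: eq_bigr => z _; exact: multiplicity_pi.
by move=> z Dz /sl_eigenvalue_pi/root_Gamma_rep; exact: sD'.
Qed.
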